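(* Let $\boldsymbol\alpha=(\alpha_1,\dots,\alpha_{d+1})\in\mathbb{R}^{d+1}$ and $\boldsymbol\beta=(\beta_1,\dots,\beta_d)\in\mathbb{R}^d$ be strictly increasing and let $(M,N)\in\mathbb{R}_{>0}^2$ be an appropriate choice for $(\boldsymbol\alpha,\boldsymbol\beta)$. Define $\mathbf{b}\in\mathbb{R}^{\mathcal{O}_{d+1}}$ by: for $\mathcal{T}\in\mathcal{O}_{d+1}$ with $\operatorname{Type}(\mathcal{T})=(t_0,t_1,\dots,t_k,t_{k+1})$, $$b_{\mathcal{T}}=M\Big(\sum_{i=1}^{k+1} i\sum_{j=t_{i-1}+1}^{t_i}\alpha_j\Big)+N\sum_{j=d-k+1}^{d}\beta_j.$$ Then the linear system $\langle\mathbf{1},\mathbf{x}\rangle=b_{[d+1]}$, $\langle\mathbf{e}_{\mathcal{T}},\mathbf{x}\rangle\le b_{\mathcal{T}}$ for all $\mathcal{T}\in\overline{\mathcal{O}_{d+1}}$, defines the usual nested permutohedron $\operatorname{Perm}(\boldsymbol\alpha,\boldsymbol\beta;M,N)$.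
   Context: For $\pi\in\mathfrak{S}_{d+1}$ and $1\le i\le d$ let $\mathbf{f}^\pi_i=\mathbf{e}_{\pi^{-1}(i+1)}-\mathbf{e}_{\pi^{-1}(i)}$. For $(\pi,\tau)\in\mathfrak{S}_{d+1}\times\mathfrak{S}_d$ let $v_{\pi,\tau}=M\sum_{i=1}^{d+1}\alpha_i\mathbf{e}_{\pi^{-1}(i)}+N\sum_{i=1}^d\beta_i\mathbf{f}^\pi_{\tau^{-1}(i)}=\sum_{i=1}^{d+1}\big(M\alpha_i+N(\beta_{\tau(i-1)}-\beta_{\tau(i)})\big)\mathbf{e}_{\pi^{-1}(i)}$, with the convention $\beta_{\tau(0)}=\beta_{\tau(d+1)}=0$. $(M,N)$ is an appropriate choice for $(\boldsymbol\alpha,\boldsymbol\beta)$ if for every $\tau\in\mathfrak{S}_d$ the coefficients $M\alpha_i+N(\beta_{\tau(i-1)}-\beta_{\tau(i)})$ are strictly increasing in $i=1,\dots,d+1$. The usual nested permutohedron is $\operatorname{Perm}(\boldsymbol\alpha,\boldsymbol\beta;M,N)=\mathrm{conv}\{v_{\pi,\tau}:(\pi,\tau)\in\mathfrak{S}_{d+1}\times\mathfrak{S}_d\}$. $\mathcal{O}_{d+1}$ is the set of ordered set partitions $\mathcal{T}=S_1|\cdots|S_{k+1}$ of $[d+1]$ (nonempty disjoint blocks with union $[d+1]$), $[d+1]$ denotes the one-block partition, and $\overline{\mathcal{O}_{d+1}}=\mathcal{O}_{d+1}\setminus\{[d+1]\}$. For such $\mathcal{T}$, $\mathbf{e}_{\mathcal{T}}=\sum_i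 i\sum_{j\in S_i}\mathbf{e}_j$, and $\operatorname{Type}(\mathcal{T})=(t_0,t_1,\dots,t_{k+1})$ with $t_0=0$, $t_i=|S_1|+\cdots+|S_i|$ (so $t_{k+1}=d+1$). $\mathbf{1}$ is the all-one vector. *)

(* Defs.v *)
From HB Require Import structures.
From mathcomp Require Import all_boot all_order all_algebra all_fingroup.
From mathcomp Require Import all_classical all_reals.
From mathcomp Require Import convex.

Set Implicit Arguments.
Unset Strict Implicit.
Unset Printing Implicit Defensive.

Import Order.TTheory GRing.Theory Num.Theory.
Local Open Scope ring_scope.

(* The coordinates and the elements of {1, ..., n} are represented by 'I_n:
   the mathematical index i is the ordinal of value i - 1.  The positions of
   the blocks of an ordered set partition, which are natural numbers, keep
   their 1-based numbering. *)

Definition strictly_increasing (R : realType) n (u : 'I_n -> R) : Prop :=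
  forall i j : 'I_n, (i < j)%N -> u i < u j.

Definition dot (R : realType) n (u v : 'rV[R]_n) : R :=
  \sum_(i < n) u 0 i * v 0 i.

Definition convex_hull (R : realType) (V : lmodType R) (A : set V) : set V :=
  smallest (@convex_set R V) A.

Section UsualNestedPermutohedron.
Variables (R : realType) (d : nat).
Implicit Types (alpha : 'rV[R]_d.+1) (beta : 'rV[R]_d) (M N : R).
Implicit Types (pi : 'S_d.+1) (tau : 'S_d).

Definition ebasis (i : 'I_d.+1) : 'rV[R]_d.+1 := delta_mx 0 i.

(* For i : 'I_d, [lift ord0 i] has value i + 1 and [lift ord_max i] has
   value i, both in 'I_d.+1. *)
Definition fvec pi (i : 'I_d) : 'rV[R]_d.+1 :=
  ebasis ((pi^-1)%g (lift ord0 i)) - ebasis ((pi^-1)%g (lift ord_max i)).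

Definition nested_vertex alpha beta M N (pt : 'S_d.+1 * 'S_d) : 'rV[R]_d.+1 :=
  M *: (\sum_(i < d.+1) alpha 0 i *: ebasis ((pt.1^-1)%g i)) +
  N *: (\sum_(i < d) beta 0 i *: fvec pt.1 ((pt.2^-1)%g i)).

(* M alpha_i + N (beta_{tau(i-1)} - beta_{tau(i)}).  [unlift ord0 i] is the
   index i - 1 in 'I_d, undefined at the first i, and [unlift ord_max i] is
   the index i in 'I_d, undefined at the last i; the default value 0 is the
   convention beta_{tau(0)} = beta_{tau(d+1)} = 0. *)
Definition nested_coef alpha beta M N tau (i : 'I_d.+1) : R :=
  M * alpha 0 i +
  N * (oapp (fun j => beta 0 (tau j)) 0 (unlift ord0 i) -
       oapp (fun j => beta 0 (tau j)) 0 (unlift ord_max i)).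

Lemma nested_vertexE alpha beta M N pi tau :
  nested_vertex alpha beta M N (pi, tau) =
  \sum_(i < d.+1) nested_coef alpha beta M N tau i *: ebasis ((pi^-1)%g i).
Proof.
pose b (o : option 'I_d) := oapp (fun j => beta 0 (tau j)) 0 o.
have sumE (h : 'I_d.+1) : \sum_(i < d.+1) b (unlift h i) *: ebasis ((pi^-1)%g i)
    = \sum_(i < d) beta 0 (tau i) *: ebasis ((pi^-1)%g (lift h i)).
  rewrite (bigD1_ord h) //= unlift_none /= scale0r add0r.
  by apply: eq_bigr => i _; rewrite liftK.
rewrite /nested_vertex /= (reindex_inj (@perm_inj _ tau)) /=.
under [X in _ + N *: X]eq_bigr => i _ do rewrite permK scalerBr.
rewrite big_split /= sumrN -!sumE -sumrN -big_split /= !scaler_sumr -big_split /=.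
by apply: eq_bigr => i _; rewrite -scalerBl !scalerA -scalerDl.
Qed.

Definition appropriate_choice alpha beta M N : Prop :=
  forall tau, strictly_increasing (nested_coef alpha beta M N tau).

Definition usual_nested_permutohedron alpha beta M N : set 'rV[R]_d.+1 :=
  convex_hull (range (nested_vertex alpha beta M N)).

End UsualNestedPermutohedron.

(* [finset.partition] makes the blocks nonempty, pairwise disjoint and
   covering; with [uniq], a sequence lists each block exactly once. *)
Record ordered_set_partition (d : nat) := OrderedSetPartition {
  blocks :> seq {set 'I_d.+1};
  blocksP : uniq blocks && finset.partition [set:: blocks] [set: 'I_d.+1]
}.

HB.instance Definition _ d := [isSub for @blocks d].
HB.instance Definition _ d := [Equality of ordered_set_partition d by <:].

Lemma one_blockP d (S := [:: [set: 'I_d.+1]]) :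
  uniq S && finset.partition [set:: S] [set: 'I_d.+1].
Proof.
rewrite /S /finset.partition finset.set_seq1 /finset.cover finset.big_set1 eqxx finset.trivIset1 !inE /=.
by apply/eqP => /setP/(_ ord0); rewrite !inE.
Qed.

Definition one_block d : ordered_set_partition d :=
  OrderedSetPartition (one_blockP d).

Section LinearSystem.
Variables (R : realType) (d : nat).
Implicit Types T : ordered_set_partition d.

(* S_i, for 1 <= i <= size T *)
Definition block T (i : nat) : {set 'I_d.+1} := nth finset.set0 T i.-1.

(* the sequence (t_0, ..., t_(k+1)), where k + 1 = size T *)
Definition osp_type T : seq nat :=
  mkseq (fun i => \sum_(1 <= l < i.+1) #|block T l|)%N (size T).+1.

Definition evec T : 'rV[R]_d.+1 :=
  \sum_(1 <= i < (size T).+1) i%:R *: \sum_(j in block T i) ebasis R j.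

(* The conditions t_(i-1) <= j < t_i and d - k <= j on the 0-based index j are
   t_(i-1) + 1 <= j <= t_i and d - k + 1 <= j on the 1-based one.  Since
   k <= d, the subtraction d - k is not truncated. *)
Definition nested_rhs (alpha : 'rV[R]_d.+1) (beta : 'rV[R]_d) (M N : R) T : R :=
  let k := (size T).-1 in
  let t := nth 0%N (osp_type T) in
  M * (\sum_(1 <= i < k.+2)
         i%:R * \sum_(j < d.+1 | (t i.-1 <= j < t i)%N) alpha 0 j) +
  N * \sum_(j < d | (d - k <= j)%N) beta 0 j.

Definition solution_set (b : ordered_set_partition d -> R) : set 'rV[R]_d.+1 :=
  [set x | dot (const_mx 1) x = b (one_block d) /\
           forall T, T != one_block d -> dot (evec T) x <= b T]%classic.

End LinearSystem.

(* Main.v *)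
From HB Require Import structures.
Require Import Defs.
From mathcomp Require Import all_boot all_order all_algebra all_fingroup.
From mathcomp Require Import all_classical all_reals.
From mathcomp Require Import interval_inference convex topology normedtype derive.
From mathcomp Require Import ring lra zify.
Import Order.TTheory GRing.Theory Num.Theory.
Import numFieldNormedType.Exports.
Local Open Scope ring_scope.

Set Implicit Arguments.
Unset Strict Implicit.
Unset Printing Implicit Defensive.

(* The vertices satisfy the inequalities by rearrangement.  Conversely, a
   solution outside the polytope would be strictly separated from all the
   vertices by some [w].  Sorting the coordinates of [w], and then the gaps
   between consecutive sorted coordinates, writes [w] as a multiple of the
   all-one vector plus a nonnegative combination of vectors [evec T], all of
   them tight at one common vertex [v].  Adding up the corresponding
   inequalities gives [dot w x <= dot w v] for every solution [x]. *)

(** * Bilinearity and positivity of the dot product *)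

Section DotProduct.
Variables (R : realType) (n : nat).
Implicit Types u v w : 'rV[R]_n.

Lemma dotC u v : dot u v = dot v u.
Proof. by apply: eq_bigr => i _; rewrite mulrC. Qed.

Lemma dot_is_linear u : linear (dot u : 'rV[R]_n -> R^o).
Proof.
move=> a v w; rewrite /dot scaler_sumr -big_split /=.
by apply: eq_bigr => i _; rewrite !mxE mulrDr mulrCA.
Qed.

HB.instance Definition _ u :=
  GRing.isLinear.Build R 'rV[R]_n R^o _ (dot u) (dot_is_linear u).

Lemma dotDr u v w : dot u (v + w) = dot u v + dot u w.
Proof. exact: raddfD. Qed.

Lemma dotZr u a v : dot u (a *: v) = a * dot u v.
Proof. exact: linearZ. Qed.

Lemma dotDl u v w : dot (v + w) u = dot v u + dot w u.
Proof. by rewrite dotC dotDr !(dotC u). Qed.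

Lemma dotZl u a v : dot (a *: v) u = a * dot v u.
Proof. by rewrite dotC dotZr dotC. Qed.

Lemma dot_sumr (I : Type) (r : seq I) (P : pred I) (F : I -> 'rV[R]_n) u :
  dot u (\sum_(i <- r | P i) F i) = \sum_(i <- r | P i) dot u (F i).
Proof. exact: raddf_sum. Qed.

Lemma dot_suml (I : Type) (r : seq I) (P : pred I) (F : I -> 'rV[R]_n) u :
  dot (\sum_(i <- r | P i) F i) u = \sum_(i <- r | P i) dot (F i) u.
Proof. by rewrite dotC dot_sumr; under eq_bigr do rewrite dotC. Qed.

Lemma dotBr u v w : dot u (v - w) = dot u v - dot u w.
Proof. exact: raddfB. Qed.

Lemma dotBl u v w : dot (v - w) u = dot v u - dot w u.
Proof. by rewrite dotC dotBr !(dotC u). Qed.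

Lemma dot_ge0 u : 0 <= dot u u.
Proof. by apply: sumr_ge0 => i _; rewrite -expr2 sqr_ge0. Qed.

Lemma dot_gt0 u : u != 0 -> 0 < dot u u.
Proof.
move=> u_neq0; rewrite lt_def dot_ge0 andbT; apply: contra u_neq0 => /eqP uu0.
apply/eqP/rowP => i; rewrite mxE; apply/eqP; rewrite -sqrf_eq0 expr2.
by apply/eqP; apply: (psumr_eq0P _ uu0) => // j _; rewrite -expr2 sqr_ge0.
Qed.

Lemma dot_sqrB u v (t : R) :
  dot (u - t *: v) (u - t *: v) = dot u u - t * (2 * dot u v) + t * (t * dot v v).
Proof. by rewrite dotBl !dotBr !dotZl !dotZr (dotC v u); ring. Qed.

End DotProduct.

(** * Convex sets and finite convex combinations *)

Section Convexity.
Variables (R : realType) (V : lmodType R).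
Implicit Type C : set V.

Lemma convex_setP C :
  convex_set C <-> forall (t : R) x y, 0 <= t <= 1 -> C x -> C y ->
    C (t *: x + (1 - t) *: y).
Proof.
split=> [cC t x y /andP[t0 t1] Cx Cy|cC x y t /set_mem Cx /set_mem Cy].
  pose t' := Itv01 t0 t1.
  by have := cC x y t' (mem_set Cx) (mem_set Cy); rewrite inE.
by apply: mem_set; apply: cC => //; rewrite ge0 le1.
Qed.

Lemma convex_set_sum C : convex_set C ->
  forall (I : Type) (r : seq I) (a : I -> R) (v : I -> V),
    (forall i, 0 <= a i) -> (forall i, C (v i)) ->
    \sum_(i <- r) a i = 1 -> C (\sum_(i <- r) a i *: v i).
Proof.
move=> /convex_setP cC I [|i0 r] a v a_ge0 Cv.
  by rewrite big_nil => /esym/eqP; rewrite oner_eq0.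
(* Stated for an arbitrary total weight so that the induction applies: a partial sum is its total
   weight times a point of [C]. *)
move=> a1; suff [y Cy ->] : exists2 y, C y &
    \sum_(i <- i0 :: r) a i *: v i = (\sum_(i <- i0 :: r) a i) *: y.
  by rewrite a1 scale1r.
elim: {a1}(i0 :: r) => [|i s [y Cy IHs]].
  by exists (v i0); rewrite // !big_nil scale0r.
have s_ge0 : 0 <= \sum_(j <- s) a j by apply: sumr_ge0.
rewrite !big_cons IHs; set b := \sum_(j <- s) a j in s_ge0 *.
have [ab0|ab_neq0] := eqVneq (a i + b) 0.
  exists y => //; rewrite ab0; have := a_ge0 i => ai_ge0.
  have [-> ->] : a i = 0 /\ b = 0 by split; lra.
  by rewrite !scale0r addr0.
exists (a i / (a i + b) *: v i + (1 - a i / (a i + b)) *: y).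
  apply: cC => //; have ab_gt0 : 0 < a i + b by rewrite lt_def ab_neq0 addr_ge0.
  by rewrite divr_ge0 ?addr_ge0 //= ler_pdivrMr // mul1r lerDl.
rewrite scalerDr !scalerA; congr (_ *: _ + _ *: _); by field.
Qed.

Lemma convex_hull_convex C : convex_set (convex_hull C).
Proof.
apply/convex_setP => t x y t01 Cx Cy A [cA sCA].
by have /convex_setP cA' := cA; apply: (cA' t x y t01 (Cx A _) (Cy A _)).
Qed.

End Convexity.

(** * Strict separation of a point from the hull of a finite family *)

Section Separation.
Local Open Scope classical_set_scope.
Variable R : realType.

Definition simplex n : set 'rV[R]_n :=
  [set a | (forall i, 0 <= a 0 i) /\ \sum_i a 0 i = 1].
Arguments simplex : clear implicits.

Lemma sum_continuous (T : topologicalType) (I : finType) (F : I -> T -> R) :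
  (forall i, continuous (F i : T -> R^o)) ->
  continuous (fun x => \sum_i F i x : R^o).
Proof.
move=> cF; elim: (index_enum I) => [|i r IHr].
  by under eq_fun do rewrite big_nil; exact: cst_continuous.
under eq_fun do rewrite big_cons.
by move=> x; apply: cvgD; [exact: cF|exact: IHr].
Qed.

Lemma simplex_compact n : compact (simplex n).
Proof.
apply: (@subclosed_compact _ _ [set a : 'rV[R]_n | forall i, `[0, 1]%classic (a 0 i)]).
- have -> : simplex n = (\bigcap_(i in [set: 'I_n])
      (fun a : 'rV[R]_n => a 0 i : R^o) @^-1` [set x | 0 <= x]) `&`
      (fun a : 'rV[R]_n => \sum_i a 0 i : R^o) @^-1` [set 1].
    apply/seteqP; split=> a /=.
      by move=> [a0 a1]; split=> // i _; apply: a0.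
    by move=> [a0 a1]; split=> // i; apply: a0.
  apply: closedI.
    apply: closed_bigI => i _; apply: preimage_closed; last exact: closed_ge.
    by move=> a _; apply: coord_continuous.
  apply: preimage_closed; last exact: closed_eq.
  move=> a _; apply: sum_continuous => i; exact: coord_continuous.
- apply: (@rV_compact R^o n (fun=> `[0, 1]%classic)) => i; exact: segment_compact.
- move=> a [a0 a1] i /=; rewrite in_itv /= a0 /= -a1 (bigD1 i) //= lerDl.
  by apply: sumr_ge0.
Qed.

(* The normal of the separating hyperplane is the difference between [x] and
   its nearest point in the hull. *)
Lemma convex_hull_separation n (I : finType) (v : I -> 'rV[R]_n) x :
  ~ convex_hull (range v) x -> exists w, forall i, dot w (v i) < dot w x.
Proof.
move=> x_notin.
(* An empty [I] imposes no condition on [w]; otherwise [i0] makes the simplex nonempty, so that a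
   minimum exists. *)
have [/existsP[i0 _]|/existsPn noI] := boolP [exists i : I, true]; last first.
  by exists 0 => i; have := noI i.
(* Barycentric coordinates turn the search for a nearest point into a minimisation over a compact
   simplex. *)
pose p (a : 'rV[R]_#|I|) := \sum_(j < #|I|) a 0 j *: v (enum_val j).
pose f (a : 'rV[R]_#|I|) : R := dot (x - p a) (x - p a).
pose e i : 'rV[R]_#|I| := delta_mx 0 (enum_rank i).
have pe i : p (e i) = v i.
  rewrite /p (bigD1 (enum_rank i)) //= !mxE !eqxx scale1r enum_rankK.
  rewrite big1 ?addr0 // => j /negbTE ji; rewrite mxE ji andbF scale0r //.
have e_simplex i : simplex #|I| (e i).
  split=> [j|]; first by rewrite mxE ler0n.
  rewrite (bigD1 (enum_rank i)) //= !mxE !eqxx big1 ?addr0 // => j /negbTE ji.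
  by rewrite mxE ji andbF.
have f_cont : continuous (f : _ -> R^o).
  apply: sum_continuous => k.
  have xp_cont : continuous (fun a => (x - p a) 0 k : R^o).
    have -> : (fun a => (x - p a) 0 k) =
        fun a => x 0 k - \sum_(j < #|I|) a 0 j * v (enum_val j) 0 k.
      apply/funext => a; rewrite !mxE summxE.
      by under eq_bigr do rewrite mxE.
    have sum_cont : continuous
        (fun a : 'rV[R]_#|I| => \sum_(j < #|I|) a 0 j * v (enum_val j) 0 k : R^o).
      apply: (@sum_continuous _ _ (fun j (a : 'rV[R]_#|I|) => a 0 j * v (enum_val j) 0 k)).
      by move=> j b; exact: cvgM (@coord_continuous R 1 #|I| 0 j b) (cvg_cst _).
    by move=> a; exact: cvgB (cvg_cst _) (sum_cont a).
  by move=> a; exact: cvgM (xp_cont a) (xp_cont a).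
have [|a] := compact_EVT_min _ (@simplex_compact #|I|) (continuous_subspaceT f_cont).
  by exists (e i0).
rewrite inE => -[a_ge0 a1] a_min.
have hull_p : convex_hull (range v) (p a).
  apply: convex_set_sum => //; first exact: convex_hull_convex.
  by move=> j A [_]; apply; exists (enum_val j).
set y := p a in hull_p *.
have xy_neq0 : x - y != 0.
  by apply/eqP => /subr0_eq xy; apply: x_notin; rewrite xy.
exists (x - y) => i.
(* The angle at [y] is not acute; then [dot w (v i) <= dot w y < dot w x] for [w = x - y]. *)
suff c_le0 : dot (x - y) (v i - y) <= 0.
  have := dot_gt0 xy_neq0; rewrite [in X in 0 < X -> _]dotBr.
  move: c_le0; rewrite dotBr; lra.
set c := dot _ _; rewrite leNgt; apply/negP => c_gt0.
set q := dot (v i - y) (v i - y).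
have q_ge0 : 0 <= q by exact: dot_ge0.
(* Moving from [y] by [t] towards [v i] changes the squared distance by [t * (t * q - 2 * c)],
   negative here since [t * q < c]. The denominator [c + q] keeps [t] at most [1], even when
   [q = 0]. *)
pose t := c / (c + q).
have cq_gt0 : 0 < c + q by lra.
have t_gt0 : 0 < t by rewrite divr_gt0.
have t_le1 : t <= 1 by rewrite ler_pdivrMr // mul1r lerDl.
have ta : simplex #|I| (t *: e i + (1 - t) *: a).
  have [e_ge0 e1] := e_simplex i; split=> [j|].
    have := e_ge0 j; rewrite !mxE => ej.
    by rewrite addr_ge0 // mulr_ge0 // ?subr_ge0 // ltW.
  under eq_bigr do rewrite 2!mxE [(_ *: a) _ _]mxE.
  by rewrite big_split /= -!mulr_sumr a1 e1; ring.
have := a_min _ (mem_set ta); rewrite /f.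
have -> : p (t *: e i + (1 - t) *: a) = y + t *: (v i - y).
  have -> : p (t *: e i + (1 - t) *: a) = t *: p (e i) + (1 - t) *: p a.
    rewrite /p !scaler_sumr -big_split /=; apply: eq_bigr => j _.
    by rewrite !scalerA -scalerDl 2!mxE [(_ *: a) _ _]mxE.
  rewrite pe -/y scalerBr scalerBl scale1r; apply/eqP.
  by rewrite -subr_eq0; apply/eqP/rowP => k; rewrite !mxE; ring.
rewrite opprD addrA dot_sqrB -/y -/c -/q => a_min_t.
have : t * (2 * c) <= t * (t * q) by lra.
rewrite ler_pM2l // => ct.
have : t * (c + q) = c by rewrite divfK ?gt_eqF.
have tc_gt0 := mulr_gt0 t_gt0 c_gt0; rewrite mulrDr => tcq; lra.
Qed.

End Separation.

(** * Sums over final segments, and sorting *)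

(** Equal cardinalities allow subtracting from every term the value of [u] at the least element [m]
    of [B]. The terms are then nonnegative on [B] and nonpositive off it, so no [A] does better than
    [B]. *)
Lemma sum_le_upper_set (R : realDomainType) n (u : 'I_n -> R) (A B : {set 'I_n}) :
  (forall i j : 'I_n, (i <= j)%N -> u i <= u j) ->
  (forall i j : 'I_n, (i <= j)%N -> i \in B -> j \in B) ->
  #|A| = #|B| -> \sum_(i in A) u i <= \sum_(i in B) u i.
Proof.
move=> u_mono B_upper cardAB.
have [B0|[b bB]] := finset.set_0Vmem B.
  by rewrite B0 (_ : A = finset.set0) //; apply/eqP; rewrite -cards_eq0 cardAB B0 cards0.
pose m := [arg min_(i < b in B) (i : nat)].
have [mB m_min] : m \in B /\ forall i, i \in B -> (m <= i)%N.
  by rewrite /m; case: arg_minnP.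
have shift (C : {set 'I_n}) :
    \sum_(i in C) u i = \sum_(i in C) (u i - u m) + u m *+ #|C|.
  by rewrite sumrB sumr_const subrK.
rewrite !shift cardAB lerD2r [leLHS]big_mkcond [leRHS]big_mkcond /=.
apply: ler_sum => i _; case: (boolP (i \in B)) => [iB|iB].
  by case: ifP; rewrite // subr_ge0 u_mono // m_min.
case: ifP => // _; rewrite subr_le0 u_mono // leqNgt.
by apply: contra iB => mi; apply: B_upper mB; apply: ltnW.
Qed.

Lemma sorting_perm disp (T : orderType disp) n (f : 'I_n -> T) :
  exists s : 'S_n, forall i j : 'I_n, (i <= j)%N -> (f (s i) <= f (s j))%O.
Proof.
case: n f => [|n] f; first by exists 1%g => -[].
pose t := [tuple f i | i < n.+1].
have /tuple_permP[s st] : perm_eq (sort <=%O t) t by rewrite perm_sort.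
exists s => i j ij.
have nth_sort (k : 'I_n.+1) : f (s k) = nth (f ord0) (sort <=%O t) k.
  by rewrite st -tnth_nth !tnth_mktuple.
rewrite !nth_sort; apply: sorted_leq_nth => //.
- exact: le_trans.
- exact: sort_le_sorted.
- by rewrite inE size_sort size_tuple.
- by rewrite inE size_sort size_tuple.
Qed.

Lemma sum_nat_pred1 (V : nmodType) m n l (F : nat -> V) : (m <= l < n)%N ->
  \sum_(m <= i < n | i == l) F i = F l.
Proof.
move=> ml; rewrite big_mkcond (bigD1_seq l) ?iota_uniq ?mem_index_iota //= eqxx.
by rewrite big1 ?addr0 // => i /negbTE ->.
Qed.

(** * Counting functions of sets of cuts *)

Section GapsBelow.
Variable d : nat.
Implicit Types (G : {set 'I_d}) (c : 'I_d).

(** With [c] in [G] read as a cut between the positions [c] and [c + 1], this is the 0-based index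
    of the block containing position [j]. *)
Definition gaps_below G (j : nat) : nat := (\sum_(c in G) (c < j))%N.

Lemma gaps_below0 G : gaps_below G 0 = 0%N.
Proof. by rewrite /gaps_below big1. Qed.

Lemma gaps_belowS G c : gaps_below G c.+1 = (gaps_below G c + (c \in G))%N.
Proof.
have -> : (c \in G : nat) = (\sum_(c' in G) (c' == c))%N.
  rewrite big_mkcond (bigD1 c) //= eqxx big1 ?addn0 => [|c' /negbTE ->].
    by case: (c \in G).
  by case: ifP.
rewrite /gaps_below -big_split /=; apply: eq_bigr => c' _.
rewrite -val_eqE /=; lia.
Qed.

Lemma gaps_below_max G : gaps_below G d = #|G|.
Proof. by rewrite -sum1_card; apply: eq_bigr => c _; rewrite ltn_ord. Qed.

Lemma leq_gaps_below G i j : (i <= j)%N -> (gaps_below G i <= gaps_below G j)%N.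
Proof. by move=> ij; apply: leq_sum => c _; lia. Qed.

(** Discrete intermediate values: the count starts at [0], ends at [#|G|] and rises by at most one,
    so it equals [i] where it first reaches [i]. *)
Lemma gaps_below_onto G i : (i <= #|G|)%N -> exists j : 'I_d.+1, gaps_below G j = i.
Proof.
move=> iG; have ex_j : exists j, (i <= gaps_below G j)%N.
  by exists d; rewrite gaps_below_max.
case: (ex_minnP ex_j) => j ij j_min.
have jd : (j < d.+1)%N by rewrite ltnS j_min // gaps_below_max.
exists (Ordinal jd) => /=; case: j => [|j] in ij j_min jd *.
  by move: ij; rewrite gaps_below0; lia.
have jS := gaps_belowS G (Ordinal (jd : (j < d)%N)).
have := contraNN (j_min j); rewrite -ltnNge ltnSn => /(_ isT).
by move: ij; rewrite jS /=; case: (_ \in _); lia.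
Qed.

(** A nondecreasing map onto [0, ..., k] skips no value, so it rises by at most one at each step and
    counts its own ascents. *)
Lemma gaps_below_ascents (m : 'I_d.+1 -> nat) k :
  (forall i j : 'I_d.+1, (i <= j)%N -> (m i <= m j)%N) ->
  (forall i, (m i <= k)%N) -> (forall l, (l <= k)%N -> exists i, m i = l) ->
  exists2 G : {set 'I_d}, #|G| = k & forall j : 'I_d.+1, m j = gaps_below G j.
Proof.
move=> m_mono m_le m_onto.
pose G := [set c : 'I_d | (m (lift ord_max c) < m (lift ord0 c))%N]%SET.
have mE j : forall jd : (j < d.+1)%N, m (Ordinal jd) = gaps_below G j.
  elim: j => [|j IHj] jd.
    rewrite gaps_below0; have [i i0] := m_onto 0%N isT.
    by have := m_mono (Ordinal jd) i; rewrite i0 /=; lia.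
  pose c := Ordinal (jd : (j < d)%N).
  have cmax : lift ord_max c = Ordinal (ltnW jd).
    by apply/val_inj; rewrite /= /bump leqNgt (jd : (j < d)%N).
  have c0 : lift ord0 c = Ordinal jd by apply/val_inj.
  rewrite (gaps_belowS G c) -(IHj (ltnW jd)) !inE cmax c0.
  have := m_mono (Ordinal (ltnW jd)) (Ordinal jd) (leqnSn j).
  case: ltnP => /= [lt_m _|]; last by lia.
  have [|i mi] := m_onto (m (Ordinal (ltnW jd))).+1.
    exact: leq_trans lt_m (m_le _).
  have [ij|ji] := leqP i j.
    by have := m_mono i (Ordinal (ltnW jd)) ij; lia.
  by have := m_mono (Ordinal jd) i ji; lia.
have mE' (j : 'I_d.+1) : m j = gaps_below G j.
  by rewrite -(mE _ (ltn_ord j)); congr m; apply/val_inj.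
exists G => //; rewrite -gaps_below_max.
apply/eqP; rewrite eqn_leq -(mE d (ltnSn d)) m_le /=.
by have [i <-] := m_onto k (leqnn k); apply: m_mono; rewrite /= -ltnS.
Qed.

End GapsBelow.

(** * Ordered set partitions as level functions *)

Section Levels.
Variable d : nat.
Implicit Types (T : ordered_set_partition d) (x : 'I_d.+1).

Definition level T x : nat := (find (fun S : {set _} => x \in S) T).+1.

Lemma level_le_size T x : (level T x <= size T)%N.
Proof.
have /andP[_ /and3P[/eqP covT _ _]] := blocksP T.
rewrite -has_find; apply/hasP.
have : x \in finset.cover [set:: blocks T]%SET by rewrite covT finset.in_setT.
by case/bigcupP => S; rewrite finset.inE => ST xS; exists S.
Qed.

(** Distinct positions carry distinct, hence disjoint, blocks, so the first block containing [x] is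
    the only one. *)
Lemma in_block T x i : (0 < i <= size T)%N -> (x \in block T i) = (level T x == i).
Proof.
case: i => [//|i] /= iT; rewrite /block /= /level eqSS.
have /andP[uT /and3P[_ /finset.trivIsetP disjT _]] := blocksP T.
have lx : (find (fun S : {set _} => x \in S) T < size T)%N := level_le_size T x.
have xl : x \in nth finset.set0 T (find (fun S : {set _} => x \in S) T).
  by apply: (nth_find finset.set0 (a := fun S : {set _} => x \in S)); rewrite has_find.
apply/idP/eqP => [xi|<- //]; apply/eqP; rewrite -(nth_uniq finset.set0 _ _ uT) //.
apply/negPn/negP => ne; have := disjT _ _ _ _ ne; rewrite !finset.inE !mem_nth //.
by move=> /(_ isT isT)/pred0P/(_ x) /=; rewrite xl xi.
Qed.

Lemma level_onto T i : (0 < i <= size T)%N -> exists x, level T x = i.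
Proof.
move=> iT; have /andP[_ /and3P[_ _ T0]] := blocksP T.
have [Ti0|[x]] := finset.set_0Vmem (block T i).
  have : block T i \in blocks T by apply: mem_nth; case: i iT {Ti0}.
  by rewrite Ti0 => T0'; case/negP: T0; rewrite finset.inE.
by rewrite in_block // => /eqP; exists x.
Qed.

Lemma evecE (R : realType) T x : evec R T 0 x = (level T x)%:R.
Proof.
rewrite /evec summxE.
have -> : (level T x)%:R = \sum_(1 <= i < (size T).+1) (if i == level T x then i%:R else 0) :> R.
  by rewrite -big_mkcond sum_nat_pred1 //= ltnS level_le_size.
apply: eq_big_nat => i iT; rewrite mxE summxE.
rewrite (eq_bigr (fun j => (j == x)%:R)); last first.
  by move=> j _; rewrite mxE eqxx eq_sym.
rewrite eq_sym -in_block; last by lia.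
rewrite big_mkcond (bigD1 x) //= eqxx big1 ?addr0 => [|j /negbTE ->].
  by case: ifP; rewrite ?mulr1 ?mulr0.
by case: ifP.
Qed.

Lemma osp_typeE T i : (i <= size T)%N ->
  nth 0%N (osp_type T) i = #|[set x | (level T x <= i)%N]%SET|.
Proof.
move=> iT; rewrite nth_mkseq; last by rewrite ltnS.
elim: i iT => [|i IHi] iT; last first.
  rewrite big_nat_recr //= IHi; last exact: ltnW.
  rewrite -cardsUI (_ : (_ :&: block T i.+1)%SET = finset.set0) ?cards0 ?addn0.
    by apply: eq_card => x; rewrite !finset.inE in_block //; lia.
  by apply/finset.setP => x; rewrite !finset.inE in_block //; lia.
rewrite big_geq //; apply/esym/eqP; rewrite cards_eq0.
by apply/eqP/finset.setP => x; rewrite !finset.inE.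
Qed.

(** The blocks are the fibres of [l] in order of value; surjectivity makes them nonempty, hence
    distinct. *)
Lemma osp_of_levels (l : 'I_d.+1 -> nat) k :
  (forall x, (l x <= k)%N) -> (forall i, (i <= k)%N -> exists x, l x = i) ->
  exists2 T : ordered_set_partition d, size T = k.+1 & forall x, level T x = (l x).+1.
Proof.
move=> l_le l_onto.
pose B i := [set x | l x == i]%SET.
have inB x i : (x \in B i) = (l x == i) by rewrite finset.in_set.
have BP : uniq (mkseq B k.+1) && finset.partition [set:: mkseq B k.+1]%SET [set: 'I_d.+1].
  apply/andP; split.
    apply/mkseq_uniqP => i j; rewrite !inE !ltnS => ik jk Bij.
    have [x xi] := l_onto i ik.
    by have := inB x i; rewrite xi eqxx Bij inB xi => /eqP.
  apply/and3P; split.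
  - apply/eqP/setP => x; rewrite finset.in_setT; apply/bigcupP.
    exists (B (l x)); last by rewrite inB.
    by rewrite finset.in_set; apply: map_f; rewrite mem_iota /= ltnS.
  - apply/finset.trivIsetP => S1 S2; rewrite !finset.in_set => /mapP[i _ ->] /mapP[j _ ->] Bij.
    apply/pred0P => x /=; rewrite !inB; apply/negP => /andP[/eqP xi /eqP xj].
    by move: Bij; rewrite -xi -xj eqxx.
  - rewrite finset.in_set; apply/negP => /mapP[i]; rewrite mem_iota /= ltnS => ik Bi.
    by have [x xi] := l_onto i ik; have := inB x i; rewrite -Bi xi eqxx finset.in_set.
exists (OrderedSetPartition BP) => [|x]; first by rewrite size_mkseq.
apply/eqP; rewrite -in_block; last by rewrite [size _]size_mkseq !ltnS l_le.
by rewrite /block /= nth_mkseq ?inB // ltnS.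
Qed.

End Levels.

(** Sublevel sets of a nondecreasing [m] are initial segments, determined by their size. This
    translates bounds by entries of [osp_type] into bounds on levels. *)
Lemma ltn_card_sublevel n (m : 'I_n -> nat) i (j : 'I_n) :
  (forall i j : 'I_n, (i <= j)%N -> (m i <= m j)%N) ->
  (j < #|[set j' | (m j' <= i)%N]%SET|)%N = (m j <= i)%N.
Proof.
move=> m_mono; have card_initial (k : nat) (kn : (k <= n)%N) :
    #|[set j' : 'I_n | (j' < k)%N]%SET| = k.
  have widen_inj : injective (widen_ord kn) by move=> x y [/val_inj].
  rewrite -[RHS]card_ord -(card_imset _ widen_inj).
  apply: eq_card => x; rewrite finset.in_set; apply/idP/imsetP => [xk|[y _ ->]] /=.
    by exists (Ordinal xk) => //; apply/val_inj.
  exact: ltn_ord.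
apply/idP/idP => [|mji].
  apply: contraLR; rewrite -!ltnNge ltnS => ij.
  rewrite -[leqRHS](card_initial j); last exact: ltnW.
  apply: subset_leq_card; apply/fintype.subsetP => x; rewrite !finset.in_set => xi.
  by rewrite ltnNge; apply/negP => /m_mono; lia.
rewrite -[X in (X <= _)%N](card_initial j.+1) //.
apply: subset_leq_card; apply/fintype.subsetP => x; rewrite !finset.in_set ltnS => xj.
exact: leq_trans (m_mono _ _ xj) mji.
Qed.

(** * Ordered set partitions as cuts of a listing of the coordinates *)

Section Gaps.
Variable d : nat.
Implicit Types (T : ordered_set_partition d) (s : 'S_d.+1) (G : {set 'I_d}).

(* Listing the coordinates as [s 0, ..., s d], the blocks of [T] are the
   maximal runs of positions without a cut, where [c] in [G] is a cut between
   the positions [c] and [c + 1]. *)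
Definition osp_cuts T s G : Prop :=
  size T = #|G|.+1 /\ forall j : 'I_d.+1, level T (s j) = (gaps_below G j).+1.

Lemma osp_cutsP T : exists s G, osp_cuts T s G.
Proof.
have [s s_mono] := sorting_perm (level T); exists s.
have T_gt0 : (0 < size T)%N by have := level_le_size T ord0; rewrite /level; lia.
have [i j ij|i|l lT|G GT mG] := @gaps_below_ascents d (fun j => (level T (s j)).-1) (size T).-1.
- by have := s_mono i j ij; rewrite leEnat; lia.
- by have := level_le_size T (s i); lia.
- have [|x xl] := @level_onto _ T l.+1; first by lia.
  by exists ((s^-1)%g x); rewrite permKV xl.
exists G; split; first by lia.
by move=> j; rewrite -mG.
Qed.

Lemma osp_of_cuts s G : exists T, osp_cuts T s G.
Proof.
have [x|i iG|T sizeT levelT] :=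
    @osp_of_levels d (fun x => gaps_below G ((s^-1)%g x)) #|G|.
- by rewrite -(gaps_below_max G) leq_gaps_below // -ltnS.
- by have [j ji] := gaps_below_onto iG; exists (s j); rewrite permK.
by exists T; split=> // j; rewrite levelT permK.
Qed.

Lemma osp_cuts_one_block s : osp_cuts (one_block d) s finset.set0.
Proof.
split=> [|j]; first by rewrite cards0.
rewrite /gaps_below big_set0 /=; have := level_le_size (one_block d) (s j).
by rewrite /level /=; case: ifP.
Qed.

(** * Right-hand sides and vertex values in terms of cuts *)

Variables (R : realType) (alpha : 'rV[R]_d.+1) (beta : 'rV[R]_d) (M N : R).

Lemma nested_rhsE T s G : osp_cuts T s G ->
  nested_rhs alpha beta M N T =
  M * (\sum_(j < d.+1) alpha 0 j * (gaps_below G j).+1%:R) +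
  N * \sum_(j < d | (d - #|G| <= j)%N) beta 0 j.
Proof.
move=> [sizeT levelT]; rewrite /nested_rhs sizeT /=; congr (M * _ + _).
have mono (i j : 'I_d.+1) : (i <= j)%N -> (level T (s i) <= level T (s j))%N.
  by move=> ij; rewrite !levelT ltnS leq_gaps_below.
have typeE i (j : 'I_d.+1) : (i <= size T)%N ->
    (j < nth 0%N (osp_type T) i)%N = (level T (s j) <= i)%N.
  move=> iT; rewrite osp_typeE // -(ltn_card_sublevel _ _ mono).
  congr (_ < _)%N; rewrite -[LHS](card_preimset _ (@perm_inj _ s)).
  by apply: eq_card => x; rewrite !finset.in_set.
(* Each [j] lies between consecutive entries of the type for exactly one [i], the level of [s j], so
   exchanging the sums leaves one term per [j]. *)
transitivity (\sum_(j < d.+1) \sum_(1 <= i < #|G|.+2 | i == level T (s j)) i%:R * alpha 0 j).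
  under [RHS]eq_bigr do rewrite big_mkcond /=.
  rewrite exchange_big /=; apply: eq_big_nat => i iG.
  rewrite mulr_sumr big_mkcond /=; apply: eq_bigr => j _; congr (if _ then _ else _).
  case: i iG => [//|i] /= iG; have iT : (i.+1 <= size T)%N by rewrite sizeT.
  rewrite (typeE _ _ iT) leqNgt (typeE _ _ (ltnW iT)); lia.
apply: eq_bigr => j _; rewrite sum_nat_pred1; first by rewrite levelT mulrC.
by rewrite ltnS -sizeT level_le_size.
Qed.

Lemma dot_ebasis (w : 'rV[R]_d.+1) i : dot w (ebasis R i) = w 0 i.
Proof.
rewrite /dot (bigD1 i) //= !mxE !eqxx mulr1 big1 ?addr0 // => j /negbTE ji.
by rewrite !mxE ji andbF mulr0.
Qed.

(** A vertex puts its [i]-th coefficient at the coordinate [pi^-1 i]; taking [s^-1] for [pi] makes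
    [s] the listing of the coordinates. *)
Lemma dot_nested_vertex (w : 'rV[R]_d.+1) s (tau : 'S_d) :
  dot w (nested_vertex alpha beta M N ((s^-1)%g, tau)) =
  M * (\sum_(j < d.+1) alpha 0 j * w 0 (s j)) +
  N * \sum_(c < d) beta 0 (tau c) * (w 0 (s (lift ord0 c)) - w 0 (s (lift ord_max c))).
Proof.
rewrite /nested_vertex dotDr !dotZr !dot_sumr invgK /=; congr (_ * _ + _ * _).
  by apply: eq_bigr => j _; rewrite dotZr dot_ebasis.
rewrite (reindex_inj (@perm_inj _ tau)) /=; apply: eq_bigr => c _.
by rewrite dotZr /fvec dotBr !dot_ebasis permK invgK.
Qed.

Lemma evec_cuts T s G j : osp_cuts T s G ->
  evec R T 0 (s j) = (gaps_below G j).+1%:R.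
Proof. by case=> _ levelT; rewrite evecE levelT. Qed.

(** Along [s], consecutive coordinates of [evec T] differ by one at a cut and agree elsewhere, so
    only the cuts contribute entries of [beta]. *)
Lemma dot_evec_vertex T s G (tau : 'S_d) : osp_cuts T s G ->
  dot (evec R T) (nested_vertex alpha beta M N ((s^-1)%g, tau)) =
  M * (\sum_(j < d.+1) alpha 0 j * (gaps_below G j).+1%:R) +
  N * \sum_(c in G) beta 0 (tau c).
Proof.
move=> TsG; rewrite dot_nested_vertex; congr (_ * _ + _ * _).
  by apply: eq_bigr => j _; rewrite (evec_cuts _ TsG).
rewrite [RHS]big_mkcond; apply: eq_bigr => c _; rewrite !(evec_cuts _ TsG) /=.
have -> : bump d c = c by rewrite /bump leqNgt ltn_ord.
have -> : bump 0 c = c.+1 by [].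
rewrite gaps_belowS -addSn natrD addrAC subrr add0r.
by case: (c \in G); rewrite ?mulr1 ?mulr0.
Qed.

Lemma card_top_set k : (k <= d)%N -> #|[set j : 'I_d | (d - k <= j)%N]%SET| = k.
Proof.
move=> kd; rewrite -gaps_below_max.
suff gapsE i : (i <= d)%N ->
    gaps_below [set j : 'I_d | (d - k <= j)%N]%SET i = (i - (d - k))%N.
  by rewrite gapsE // subKn.
elim: i => [|i IHi] id_; first by rewrite gaps_below0.
rewrite (gaps_belowS _ (Ordinal id_)) /= IHi; last exact: ltnW.
by rewrite finset.in_set /=; lia.
Qed.

(** * Validity and tightness of the inequalities at the vertices *)

Hypothesis beta_incr : strictly_increasing (fun i => beta 0 i).
Hypothesis N_gt0 : 0 < N.
Hypothesis MN_appropriate : appropriate_choice alpha beta M N.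

Lemma strictly_increasing_le n (u : 'I_n -> R) : strictly_increasing u ->
  forall i j : 'I_n, (i <= j)%N -> u i <= u j.
Proof.
move=> u_incr i j; rewrite leq_eqVlt => /orP[/eqP/val_inj -> //|/u_incr].
exact: ltW.
Qed.

Lemma sum_beta_le (tau : 'S_d) G :
  \sum_(c in G) beta 0 (tau c) <= \sum_(j < d | (d - #|G| <= j)%N) beta 0 j.
Proof.
have Gd : (#|G| <= d)%N by rewrite -[leqRHS]card_ord max_card.
rewrite -(big_imset (fun c => beta 0 c)) /=; last by move=> c c' _ _ /perm_inj.
have -> : \sum_(j < d | (d - #|G| <= j)%N) beta 0 j =
    \sum_(j in [set j : 'I_d | (d - #|G| <= j)%N]%SET) beta 0 j.
  by apply: eq_bigl => j; rewrite finset.in_set.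
apply: sum_le_upper_set; first exact: strictly_increasing_le.
  by move=> i j ij; rewrite !finset.in_set => /leq_trans; apply.
by rewrite card_imset ?card_top_set //; apply: perm_inj.
Qed.

(* Rearrangement inequality for the increasing coefficients of a vertex; the
   values of [evec T] are sums of indicators of final segments. *)
Lemma dot_evec_vertex_sort T s G (pi : 'S_d.+1) (tau : 'S_d) : osp_cuts T s G ->
  dot (evec R T) (nested_vertex alpha beta M N (pi, tau)) <=
  dot (evec R T) (nested_vertex alpha beta M N ((s^-1)%g, tau)).
Proof.
move=> TsG; pose u := nested_coef alpha beta M N tau.
have u_le : forall i j : 'I_d.+1, (i <= j)%N -> u i <= u j.
  exact: strictly_increasing_le (MN_appropriate tau).
have dotE pi' : dot (evec R T) (nested_vertex alpha beta M N (pi', tau)) =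
    \sum_i u i +
    \sum_(c in G) \sum_(i in [set i | (c < (s^-1)%g ((pi'^-1)%g i))%N]%SET) u i.
  rewrite nested_vertexE dot_sumr -/u.
  transitivity (\sum_i (u i + \sum_(c in G) if (c < (s^-1)%g ((pi'^-1)%g i))%N then u i else 0)).
    apply: eq_bigr => i _; rewrite dotZr dot_ebasis -[(pi'^-1)%g i](permKV s).
    rewrite (evec_cuts _ TsG) -add1n natrD mulrDr mulr1 natr_sum mulr_sumr.
    congr (_ + _); apply: eq_bigr => c _; rewrite permK.
    by case: ifP; rewrite ?mulr1 ?mulr0.
  rewrite big_split /= exchange_big /=; congr (_ + _); apply: eq_bigr => c _.
  by rewrite -big_mkcond; apply: eq_bigl => i; rewrite finset.in_set.
rewrite !dotE lerD2l; apply: ler_sum => c _; apply: sum_le_upper_set => //.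
  by move=> i j ij; rewrite !finset.in_set invgK !permK => /leq_trans; apply.
rewrite -[RHS](card_preimset _ (@perm_inj _ (pi^-1 * s^-1)%g)).
by apply: eq_card => i; rewrite !finset.in_set permM invgK !permK.
Qed.

(** The bound comes in two stages: over [pi] by rearrangement with [tau] fixed, then over [tau] by
    the largest entries of [beta]. *)
Lemma nested_vertex_le T (pt : 'S_d.+1 * 'S_d) :
  dot (evec R T) (nested_vertex alpha beta M N pt) <= nested_rhs alpha beta M N T.
Proof.
case: pt => pi tau; have [s [G TsG]] := osp_cutsP T.
apply: le_trans (dot_evec_vertex_sort pi tau TsG) _.
rewrite (dot_evec_vertex _ TsG) (nested_rhsE TsG) lerD2l ler_pM2l //.
exact: sum_beta_le.
Qed.

Lemma evec_one_block : evec R (one_block d) = const_mx 1.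
Proof.
apply/rowP => x; rewrite mxE -[x](permK 1%g).
by rewrite invg1 (evec_cuts _ (osp_cuts_one_block 1%g)) /gaps_below big_set0.
Qed.

(** With these cuts, [tau] maps the set of cuts onto the final segment from [m], the case of
    equality in [sum_beta_le]. *)
Lemma dot_evec_vertex_tight T s (tau : 'S_d) (m : nat) : (m <= d)%N ->
  osp_cuts T s [set c | (m <= tau c)%N]%SET ->
  dot (evec R T) (nested_vertex alpha beta M N ((s^-1)%g, tau)) =
  nested_rhs alpha beta M N T.
Proof.
move=> md TsG; rewrite (dot_evec_vertex _ TsG) (nested_rhsE TsG).
congr (_ + _ * _); rewrite [RHS](reindex_inj (@perm_inj _ tau)) /=.
apply: eq_bigl => c; rewrite finset.in_set.
have -> : #|[set c | (m <= tau c)%N]%SET| = (d - m)%N.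
  rewrite -(card_top_set (leq_subr m d)) subKn //.
  rewrite -[RHS](card_preimset _ (@perm_inj _ tau)).
  by apply: eq_card => c'; rewrite !finset.in_set.
by rewrite subKn.
Qed.

(** * Decomposition of a linear functional, and comparison of solutions with vertices *)

Lemma telescope_below (f : nat -> R) (j : nat) : (j <= d)%N ->
  \sum_(c < d) (f c.+1 - f c) * (c < j)%:R = f j - f 0%N.
Proof.
move=> jd; rewrite -telescope_sumr //.
rewrite big_mkord (big_ord_widen d (fun c => f c.+1 - f c)) // [RHS]big_mkcond /=.
by apply: eq_bigr => c _; case: ifP; rewrite ?mulr1 ?mulr0.
Qed.

(* With the coordinates of [w] sorted by [s] and the gaps between consecutive
   sorted coordinates sorted by [tau^-1], each level set of the gaps cuts out an
   ordered set partition, and [w] is a combination of the vectors [evec] of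
   these, with nonnegative coefficients except on the all-one vector. *)
Lemma evec_decomposition (w : 'rV[R]_d.+1) : exists s (tau : 'S_d) a
    (T : 'I_d -> ordered_set_partition d) (e : 'I_d -> R),
  [/\ forall m, osp_cuts (T m) s [set c | (m <= tau c)%N]%SET,
      forall m, 0 <= e m &
      w = a *: const_mx 1 + \sum_m e m *: (evec R (T m) - const_mx 1)].
Proof.
have [s s_mono] := sorting_perm (fun i => w 0 i).
pose W (j : nat) := w 0 (s (inord j)).
pose gap (c : 'I_d) := W c.+1 - W c.
have gap_ge0 c : 0 <= gap c.
  by rewrite subr_ge0 s_mono // !inordK // ltnS // ltnW.
have [r r_mono] := sorting_perm gap.
pose tau := (r^-1)%g.
have /choice[T Ts] (m : 'I_d) := osp_of_cuts s [set c | (m <= tau c)%N]%SET.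
(* The sorted gaps with a [0] in front: the sum has at most one term, and none at [m = 0]. The
   weights will be the increments of [E]. *)
pose E (m : nat) := \sum_(i < d | i.+1 == m) gap (r i).
have E0 : E 0%N = 0 by rewrite /E big_pred0.
have ES (i : 'I_d) : E i.+1 = gap (r i).
  by rewrite /E (big_pred1 i) // => i'; rewrite eqSS.
exists s, tau, (W 0%N), T, (fun m : 'I_d => E m.+1 - E m); split=> //.
  move=> [[|m] md]; rewrite ES /= ?E0 ?subr0 //.
  by rewrite (ES (Ordinal (ltnW md))) subr_ge0 r_mono /=.
apply/rowP => x; rewrite -[x](permKV s); move: ((s^-1)%g x) => j.
rewrite !mxE mulr1 summxE.
have -> : w 0 (s j) = W j by rewrite /W inord_val.
rewrite -[LHS](subrK (W 0%N)) addrC; congr (_ + _).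
rewrite -telescope_below; last by rewrite -ltnS.
(* Two telescopings combine: [W j - W 0] is the sum of the gaps at [c < j], and the gap at [c] is
   the sum of the increments with [m <= tau c]. Summed over [c] first, the indicators give
   [gaps_below] of the cuts of [T m]. *)
transitivity (\sum_(m < d) \sum_(c < d) (E m.+1 - E m) * (m < (tau c).+1)%:R * (c < j)%:R).
  rewrite exchange_big; apply: eq_bigr => c _.
  by rewrite -mulr_suml telescope_below // ES E0 subr0 /tau permKV.
apply: eq_bigr => m _; rewrite !mxE (evec_cuts _ (Ts m)) -natr1 addrK.
rewrite natr_sum mulr_sumr [RHS]big_mkcond; apply: eq_bigr => c _.
by rewrite finset.in_set ltnS; case: ifP; rewrite ?mulr1 ?mulr0 ?mul0r.
Qed.

(** Tightness for the one-block partition: taking [m = d] leaves no cut, whatever [tau] is. *)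
Lemma dot_const1_vertex pt :
  dot (const_mx 1) (nested_vertex alpha beta M N pt) =
  nested_rhs alpha beta M N (one_block d).
Proof.
case: pt => pi tau; rewrite -[pi]invgK -evec_one_block.
apply: (@dot_evec_vertex_tight _ _ _ d) => //.
rewrite (_ : finset _ = finset.set0); first exact: osp_cuts_one_block.
by apply/finset.setP => c; rewrite !inE leqNgt ltn_ord.
Qed.

Lemma solution_le_vertex (w x : 'rV[R]_d.+1) :
  solution_set (nested_rhs alpha beta M N) x ->
  exists pt, dot w x <= dot w (nested_vertex alpha beta M N pt).
Proof.
move=> [x1 xT].
have [s [tau [a [T [e [Ts e_ge0 wE]]]]]] := evec_decomposition w.
exists ((s^-1)%g, tau); set v := nested_vertex _ _ _ _ _.
have v1 : dot (const_mx 1) v = dot (const_mx 1) x by rewrite dot_const1_vertex.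
rewrite wE !(dotDl, dotZl) v1 lerD2l !dot_suml; apply: ler_sum => m _.
rewrite !(dotZl, dotBl) v1 ler_wpM2l // lerD2r.
rewrite (dot_evec_vertex_tight (ltnW (ltn_ord m)) (Ts m)).
(* The one-block partition has an equation in place of an inequality. *)
have [->|Tm] := eqVneq (T m) (one_block d); last exact: xT.
by rewrite evec_one_block x1.
Qed.

Lemma solution_set_convex (b : ordered_set_partition d -> R) :
  convex_set (solution_set b).
Proof.
apply/convex_setP => t x y /andP[t_ge0 t_le1] [x1 xT] [y1 yT]; split.
  by rewrite dotDr !dotZr x1 y1; ring.
move=> T T1; rewrite dotDr !dotZr.
have -> : b T = t * b T + (1 - t) * b T by ring.
by rewrite lerD // ler_wpM2l ?subr_ge0 // ?xT ?yT.
Qed.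

Lemma nested_vertex_solution pt :
  solution_set (nested_rhs alpha beta M N) (nested_vertex alpha beta M N pt).
Proof.
by split=> [|T _]; [exact: dot_const1_vertex|exact: nested_vertex_le].
Qed.
End Gaps.

Theorem theorem4p20 (R : realType) (d : nat)
    (alpha : 'rV[R]_d.+1) (beta : 'rV[R]_d) (M N : R)
    (alpha_incr : strictly_increasing (fun i => alpha 0 i))
    (beta_incr : strictly_increasing (fun i => beta 0 i))
    (M_gt0 : 0 < M) (N_gt0 : 0 < N)
    (MN_appropriate : appropriate_choice alpha beta M N) :
  solution_set (nested_rhs alpha beta M N) =
  usual_nested_permutohedron alpha beta M N.
Proof.
apply/seteqP; split=> [x sol_x|].
  apply: contrapT => /convex_hull_separation[w w_lt].
  by have [pt] := solution_le_vertex w sol_x; rewrite leNgt w_lt.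
apply: smallest_sub; first exact: solution_set_convex.
by move=> _ [pt _ <-]; apply: nested_vertex_solution.
Qed.
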